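(* Let $f \in \mathcal{H}$ with $f(0) \neq 0$ and let $(p_n^* )_{n\ge 0}$ be the optimal polynomial approximants to $\hat{k}_0/f$. The following are equivalent, and the smallest $M$ for which each of the statements hold is the same: (1) There exists a function $\varphi(z) = \sum_{k \ge 0} a_k z^k$ such that $p_n^* = T_n(\varphi)$ for all $n \ge M$. (2) The optimal approximants to $\hat{k}_0/f$ stabilize at $p_M^*$. (3) $p_M^*f$ is the orthogonal projection of $\hat{k}_0$ onto $[f]$. (4) $f = c\, u/p_M^*$, where $c = \sqrt{(p_M^*f)(0)}$ and $u$ is $\mathcal{H}$-inner.
   Context: $\mathcal{H}$ is a reproducing kernel Hilbert space of analytic functions on the open unit disk $\mathbb{D}$ such that the polynomials are dense in $\mathcal{H}$ and the forward shift $S: f(z)\mapsto zf(z)$ is a bounded operator on $\mathcal{H}$. For $\lambda\in\mathbb{D}$, $k_\lambda$ is the reproducing kernel: $f(\lambda)=\langle f,k_\lambda\rangle_{\mathcal{H}}$ for all $f\in\mathcal{H}$; $\hat{k}_0 = k_0/\|k_0\|_{\mathcal{H}}$ is the normalized reproducing kernel at $0$. $[f]$ is the closure in $\mathcal{H}$ of $\mathrm{span}\{z^n f: n\ge 0\}$. $\mathcal{P}_n$ is the set of complex polynomials of degree at most $n$. For $f,g\in\mathcal{H}$ with $f\not\equiv 0$, the $n$th optimal polynomial approximant to $g/f$ is the unique $p_n^*\in\mathcal{P}_n$ minimizing $\|pf-g\|_{\mathcal{H}}$ over $p\in\mathcal{P}_n$; equivalently, $p_n^* f$ is the orthogonal projection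 of $g$ onto $f\mathcal{P}_n=\{pf:p\in\mathcal{P}_n\}$. For $g$ not orthogonal to $[f]$, the optimal approximants $(p_n^* )_{n\ge 0}$ to $g/f$ are said to stabilize at $p_M^*$ if $M$ is the smallest non-negative integer such that $p_n^*=p_M^*$ for all $n\ge M$. For $h$ analytic on some domain containing the origin, $T_n(h)=\sum_{k=0}^n \frac{h^{(k)}(0)}{k!}z^k$ is its $n$th Taylor polynomial, so $T_n(\varphi)=\sum_{k=0}^n a_kz^k$ for $\varphi(z)=\sum_{k\ge0}a_kz^k$. A function $u\in\mathcal{H}$ is $\mathcal{H}$-inner if $\langle u,z^ju\rangle_{\mathcal{H}}=\delta_{j0}$ for all integers $j\ge 0$.
   Formalization: In (4) the constant is c = sqrt((p_M^* f)(0)/‖k_0‖) instead of sqrt((p_M^* f)(0)); the two agree when ‖k_0‖ = 1, and the constant as printed fails otherwise (e.g. f = 1 in H² rescaled so that ‖1‖² = 2). *)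

(* Defs.v *)
From HB Require Import structures.
From mathcomp Require Import all_boot all_order all_algebra sesquilinear.
From mathcomp Require Import complex.
From mathcomp Require Import all_classical all_reals all_analysis.
Set Implicit Arguments.
Unset Strict Implicit.
Unset Printing Implicit Defensive.
Import Order.TTheory GRing.Theory Num.Theory.
Import numFieldNormedType.Exports.
Local Open Scope classical_set_scope.
Local Open Scope ring_scope.
Local Open Scope complex_scope.

(* A reproducing kernel Hilbert space of analytic functions on the open unit
   disk D, containing the polynomials as a dense subspace, on which the forward
   shift is bounded.  An element f of the space is identified with its function
   [ev f] on D (injectively, by [ev_inj]); the values of [ev f] outside D carry
   no information.  [dot] is linear in its first argument, and [fshift], linear
   by [ev_inj], maps f(z) to z f(z). *)
Record disk_rkhs (R : realType) := DiskRkhs {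
  space :> completeNormedModType R[i];
  dot : {dot space for Num.conj};
  norm_dot : forall f, `|f| ^+ 2 = dot f f;
  ev : space -> R[i] -> R[i];
  ev_linear : forall z, `|z| < 1 -> linear_for *%R (ev ^~ z);
  ev_inj : forall f g, (forall z, `|z| < 1 -> ev f z = ev g z) -> f = g;
  ev_analytic : forall f z, `|z| < 1 -> derivable (ev f : R[i]^o -> R[i]^o) z 1;
  repker : R[i] -> space;
  repkerP : forall f z, `|z| < 1 -> ev f z = dot f (repker z);
  fshift : space -> space;
  ev_fshift : forall f z, `|z| < 1 -> ev (fshift f) z = z * ev f z;
  fshift_bounded : exists K, forall f, `|fshift f| <= K * `|f|;
  const1 : space;
  ev_const1 : forall z, `|z| < 1 -> ev const1 z = 1;
  poly_dense : dense (range (fun p : {poly R[i]} =>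
    \sum_(k < size p) p`_k *: iter k fshift const1))
}.

Arguments dot {R} d : rename.
Arguments ev {R d} f z : rename.
Arguments repker {R} d z : rename.
Arguments fshift {R d} f : rename.
Arguments const1 {R} d : rename.

Section Definitions.
Variables (R : realType) (H : disk_rkhs R).
Implicit Types (f g u x y : H) (p q : {poly R[i]}) (n M : nat).

(* The function p f; see [ev_pmul]. *)
Definition pmul p f : H := \sum_(k < size p) p`_k *: iter k fshift f.

Lemma ev_pmul p f (z : R[i]) : `|z| < 1 -> ev (pmul p f) z = p.[z] * ev f z.
Proof.
move=> z1; have evL := ev_linear z1.
have ev0 : ev (0 : H) z = 0.
  by rewrite -[X in ev X](addNr (0 : H)) -scaleN1r evL mulN1r addNr.
have ev_it k : ev (iter k fshift f) z = z ^+ k * ev f z.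
  elim: k => [|k IH]; first by rewrite mul1r.
  by rewrite iterS ev_fshift// IH exprS mulrA.
rewrite /pmul horner_coef mulr_suml.
apply: (big_ind2 (fun (x : H) (c : R[i]) => ev x z = c)) => //.
  by move=> x a y b <- <-; rewrite -[x in LHS]scale1r evL mul1r.
by move=> k _; rewrite -[_ *: _]addr0 evL ev0 addr0 ev_it mulrA.
Qed.

(* [f], the closed linear span of the functions z^n f. *)
Definition cyclic_subspace f : set H := closure (range (pmul ^~ f)).

Definition khat0 : H := `|repker H 0|^-1 *: repker H 0.

(* p is the nth optimal polynomial approximant to g / f. *)
Definition is_opa g f n p : Prop :=
  (size p <= n.+1)%N /\
  forall q, (size q <= n.+1)%N -> `|pmul p f - g| <= `|pmul q f - g|.

Definition is_orth_proj (A : set H) x y : Prop :=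
  A y /\ forall a, A a -> dot H (x - y) a = 0.

Definition is_inner u : Prop :=
  forall j, dot H u (iter j fshift u) = (j == 0)%:R.

End Definitions.

Arguments khat0 {R} H.

Definition least (P : nat -> Prop) (M : nat) : Prop :=
  P M /\ forall m, P m -> (M <= m)%N.

(* Minimality of M is part of the notion. *)
Definition stabilizes_at (T : Type) (p : nat -> T) (M : nat) : Prop :=
  least (fun m => forall n, (m <= n)%N -> p n = p m) M.

Definition has_power_series (R : realType) (phi : R[i] -> R[i])
    (a : nat -> R[i]) : Prop :=
  \forall z \near (0 : R[i]^o),
    series (fun k => a k * z ^+ k : R[i]^o) @ \oo --> (phi z : R[i]^o).

Definition taylor_poly (R : realType) (n : nat) (phi : R[i] -> R[i]) :
    {poly R[i]} :=
  \poly_(k < n.+1) (derive1n k (phi : R[i] -> R[i]^o) 0 / k`!%:R).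

(* Main.v *)
Require Import Defs.
From HB Require Import structures.
From mathcomp Require Import all_boot all_order all_algebra sesquilinear.
From mathcomp Require Import complex.
From mathcomp Require Import all_classical all_reals all_analysis.
Set Implicit Arguments.
Unset Strict Implicit.
Unset Printing Implicit Defensive.
Import Order.TTheory GRing.Theory Num.Theory.
Import numFieldNormedType.Exports.
Local Open Scope classical_set_scope.
Local Open Scope ring_scope.
Local Open Scope complex_scope.

(** All four conditions are compared with the statement that p_n = p_M for every
n >= M, called stability at M below: at each M it is equivalent to the Taylor
condition, to the projection condition and to the factorization condition, so
the sets of admissible M coincide and so do their least elements.

Write g = p_M f and e = k - g, where k is the normalized kernel at 0.  Taking
the best approximant in f P_M amounts to the orthogonality of e to f P_M
([opa_orth]), and k is orthogonal to every function vanishing at 0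
([dot_khat0_shift]).

- Projection: stability at M says that e is orthogonal to f P_n for all n
  ([stable_orthP]), hence to the closure [f] of their union ([orth_closure]).
- Taylor polynomials: if p_n = T_n(phi) from M on, consecutive approximants
  differ by a single monomial a z^n.  If a were nonzero, z^n f would be
  orthogonal to f P_(n-1); since p_n f is orthogonal to z^n f for n >= 1, this
  would give z^n f = 0.  Hence a = 0 ([taylor_stable]).  Conversely a stable
  sequence consists of the Taylor polynomials of p_M.
- Inner functions: if e is orthogonal to fP, then <g, z^j g> = <k, z^j g>
  vanishes for j >= 1, so g / |g| is inner ([orth_inner]).  Conversely, if g is a
  multiple of an inner function, then e is orthogonal to z^j g for all j; it is
  orthogonal to f P_M as well, and by Euclidean division by p_M, whose degree is
  at most M, every q f lies in gP + f P_M ([inner_orth]).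

Multiplication by a nonzero polynomial is injective on the space because its
elements are continuous on the disk and a nonzero polynomial has finitely many
zeros ([pmul_eq0]). *)

(** * Polynomials as functions *)

(** A ball of radius [e] around [a] contains the infinitely many points
a + e / (k + 2). *)
Lemma poly_near0_eq0 (K : numFieldType) (p : {poly K}) (a : K^o) :
  (\forall z \near a, p.[z] = 0) -> p = 0.
Proof.
move=> /nbhs_ballP[e /= e0 ae].
pose rs := [seq a + e / k.+2%:R | k <- iota 0 (size p)].
apply: (@roots_geq_poly_eq0 _ _ rs); last by rewrite size_map size_iota.
- apply/allP => _ /mapP[k _ ->]; apply/rootP/ae.
  rewrite -ball_normE /ball_ /= opprD addNKr normrN ger0_norm; last first.
    by rewrite divr_ge0// ltW.
  by rewrite ltr_pdivrMr ?ltr0n// ltr_pMr// ltr1n.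
- rewrite map_inj_uniq ?iota_uniq// => i j /addrI /(mulfI (lt0r_neq0 e0)).
  by move=> /invr_inj /eqP; rewrite eqr_nat => /eqP[].
Qed.

(** The topology of a field and its topology as a module over itself are
carried by different types; derivatives are taken in the latter. *)
Lemma derive1_horner (K : numFieldType) (p : {poly K}) :
  (horner p : K -> K^o)^`()%classic = horner p^`().
Proof.
suff dp x : is_derive (x : K^o) 1 (horner p : K^o -> K^o) p^`().[x].
  by apply/funext => x; rewrite derive1E; case: (dp x).
elim/poly_ind: p => [|p c IH].
  rewrite deriv0 horner0.
  have -> : horner (0 : {poly K}) = cst 0 :> (K^o -> K^o).
    by apply/funext => z; rewrite horner0.
  exact: is_derive_cst.
have -> : horner (p * 'X + c%:P) = horner p * id + cst c :> (K^o -> K^o).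
  by apply/funext => z; rewrite !hornerE.
have := is_deriveD (is_deriveM IH (is_derive_id (x : K^o) 1))
  (is_derive_cst (c : K^o) (x : K^o) 1).
congr (is_derive _ _ _ _).
rewrite derivD derivM derivX derivC !hornerE.
by rewrite /GRing.scale /= mulr1 addrC mulrC.
Qed.

Lemma derive1n_horner (K : numFieldType) (p : {poly K}) n :
  derive1n n (horner p : K -> K^o) = horner p^`(n).
Proof.
by elim: n => [|n IH]; rewrite ?derivn0// derive1nS IH derive1_horner derivnS.
Qed.

Lemma taylor_horner (R : realType) (p : {poly R[i]}) n :
  (size p <= n.+1)%N -> taylor_poly n (horner p) = p.
Proof.
move=> sp; apply/polyP => k; rewrite coef_poly derive1n_horner.
case: ltnP => [_|nk]; last by rewrite nth_default// (leq_trans sp).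
rewrite horner_coef0 coef_derivn addn0 ffactnn -[p`_k *+ _]mulr_natr.
have k0 : k`!%:R != 0 :> R[i] by rewrite pnatr_eq0 -lt0n fact_gt0.
exact: (mulfK k0).
Qed.

Lemma has_power_series_horner (R : realType) (p : {poly R[i]}) :
  has_power_series (horner p) (fun k => p`_k).
Proof.
near=> z; apply: cvg_near_cst; exists (size p) => // n /= pn.
rewrite /series /= horner_coef (big_ord_widen _ (fun k => p`_k * z ^+ k) pn).
rewrite [RHS]big_mkcond big_mkord; apply: eq_bigr => k _.
by case: ltnP => // ?; rewrite nth_default// mul0r.
Unshelve. all: by end_near. Qed.

(** * Multiplication by polynomials in the function space *)

Section PolynomialMultiples.
Variables (R : realType) (H : disk_rkhs R).
Implicit Types (f g h u : H) (p q : {poly R[i]}) (n : nat).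

Lemma disk0 : `|0 : R[i]| < 1. Proof. by rewrite normr0 ltr01. Qed.

Lemma evD g h z : `|z| < 1 -> ev (g + h) z = ev g z + ev h z.
Proof. by move=> z1; rewrite -[g in LHS]scale1r (ev_linear z1) mul1r. Qed.

Lemma ev0 z : `|z| < 1 -> ev (0 : H) z = 0.
Proof.
by move=> z1; apply: (@addrI _ (ev (0 : H) z)); rewrite -evD// !addr0.
Qed.

Lemma evZ c h z : `|z| < 1 -> ev (c *: h) z = c * ev h z.
Proof. by move=> z1; rewrite -[_ *: _]addr0 (ev_linear z1) ev0// addr0. Qed.

Lemma evB g h z : `|z| < 1 -> ev (g - h) z = ev g z - ev h z.
Proof. by move=> z1; rewrite evD// -scaleN1r evZ// mulN1r. Qed.

Lemma pmul_comp p q f : pmul p (pmul q f) = pmul (p * q) f.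
Proof. by apply: ev_inj => z z1; rewrite !ev_pmul// hornerM mulrA. Qed.

Lemma pmulD p q f : pmul (p + q) f = pmul p f + pmul q f.
Proof. by apply: ev_inj => z z1; rewrite evD// !ev_pmul// hornerD mulrDl. Qed.

Lemma pmulB p q f : pmul (p - q) f = pmul p f - pmul q f.
Proof.
by apply: ev_inj => z z1; rewrite evB// !ev_pmul// hornerD hornerN mulrBl.
Qed.

Lemma pmulZ c p f : pmul (c *: p) f = c *: pmul p f.
Proof. by apply: ev_inj => z z1; rewrite evZ// !ev_pmul// hornerZ mulrA. Qed.

Lemma pmul0 f : pmul 0 f = 0.
Proof. by apply: ev_inj => z z1; rewrite ev_pmul// horner0 mul0r ev0. Qed.

Lemma pmul1 f : pmul 1 f = f.
Proof. by apply: ev_inj => z z1; rewrite ev_pmul// hornerC mul1r. Qed.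

Lemma iter_fshiftE n f : iter n fshift f = pmul 'X^n f.
Proof.
apply: ev_inj => z z1; rewrite ev_pmul// hornerXn.
elim: n => [|n IH]; first by rewrite mul1r.
by rewrite iterS ev_fshift// IH exprS mulrA.
Qed.

Lemma pmulZr c p f : pmul p (c *: f) = c *: pmul p f.
Proof. by apply: ev_inj => z z1; rewrite ev_pmul// !evZ// ev_pmul// mulrCA. Qed.

Lemma ev_continuous h (z : R[i]^o) : `|z| < 1 ->
  {for z, continuous (ev h : R[i]^o -> R[i]^o)}.
Proof.
by move=> z1; apply/differentiable_continuous/derivable1_diffP/ev_analytic.
Qed.

(** If [h] were nonzero at a point of the disk, it would be so on a neighborhood
by continuity, and [p] would vanish there. *)
Lemma pmul_eq0 p h : pmul p h = 0 -> p != 0 -> h = 0.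
Proof.
move=> ph0 /eqP p0; apply: ev_inj => z z1; rewrite ev0//.
apply: contra_notP p0 => /eqP hz0; apply: (@poly_near0_eq0 _ p z).
have z1' : \forall w \near (z : R[i]^o), `|w| < 1.
  apply/nbhs_ballP; exists (1 - `|z|); rewrite /= ?subr_gt0// => w.
  rewrite -ball_normE /ball_ /= distrC ltrBrDr; apply: le_lt_trans.
  by rewrite -{1}[w](subrK z) ler_normD.
have hz0' : \forall w \near (z : R[i]^o), ev h w != 0.
  exact: (cvgr_neq0 _ (@ev_continuous h _ z1) hz0).
near=> w.
have w1 : `|w| < 1 by near: w.
have hw0 : ev h w != 0 by near: w.
have /eqP := ev_pmul p h w1.
by rewrite ph0 ev0// eq_sym mulf_eq0 (negbTE hw0) orbF => /eqP.
Unshelve. all: by end_near. Qed.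

Lemma pmul_inj f : f != 0 -> injective (fun p => pmul p f).
Proof.
move=> f0 p q /eqP; rewrite -subr_eq0 -pmulB => /eqP/pmul_eq0 pq0.
apply/eqP; rewrite -subr_eq0; apply: contraNT f0 => /pq0 ->.
exact: eqxx.
Qed.

End PolynomialMultiples.

(** * Orthogonality and best approximation *)

Section Orthogonality.
Variables (R : realType) (H : disk_rkhs R).
Implicit Types (e f g h x u : H) (p q : {poly R[i]}) (n M : nat).

Lemma dotC x h : dot H x h = (dot H h x)^*%R.
Proof. by rewrite hermC mul1r. Qed.

Lemma conj_norm x : `|x|^*%R = `|x|.
Proof. exact/CrealP/ger0_real. Qed.

Lemma dotBl e g h : dot H (e - g) h = dot H e h - dot H g h.
Proof. exact: linearBl. Qed.

Lemma dotZl c g h : dot H (c *: g) h = c * dot H g h.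
Proof. exact: linearZl_LR. Qed.

Lemma dotZr c g h : dot H g (c *: h) = c^*%R * dot H g h.
Proof. exact: linearZr_LR. Qed.

(** The bridge between minimality and orthogonality.  Being expressed by norms
only, the right-hand side also passes to limits in [h] by the triangle
inequality. *)
Lemma orth_normP e h :
  dot H e h = 0 <-> forall t : R[i], `|e| <= `|e + t *: h|.
Proof.
split=> [eh0 t|eh].
  rewrite -(@ler_pXn2r _ 2)// ?nnegrE// !norm_dot dnormD.
  rewrite [dot H e (_ *: _)]dotZr eh0 mulr0.
  by rewrite rmorph0 !addr0 lerDl dnorm_ge0.
have [->|h0] := eqVneq h 0; first exact: linear0r.
set d := dot H e h; set n := dot H h h.
have n_gt0 : 0 < n by rewrite dnorm_gt0.
(* This value of t makes e + t h the component of e orthogonal to h, of squared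
   norm |e|^2 - |d|^2 / n. *)
have := eh (- (d / n)).
rewrite -(@ler_pXn2r _ 2)// ?nnegrE// !norm_dot dnormD dnormZ dotZr -/n -/d.
have -> : (- (d / n))^* * d = - (`|d| ^+ 2 / n).
  rewrite rmorphN rmorphM /= fmorphV /= (CrealP (gtr0_real n_gt0)).
  by rewrite normCK mulNr mulrAC [_^* * _]mulrC.
have -> : `|- (d / n)| ^+ 2 * n = `|d| ^+ 2 / n.
  rewrite normrN normrM normfV (gtr0_norm n_gt0) exprMn exprVn -mulrA.
  by rewrite expr2 invfM mulrVK// unitfE gt_eqF.
have dn_real : `|d| ^+ 2 / n \is Num.real.
  by rewrite ger0_real// divr_ge0 ?exprn_ge0// ltW.
rewrite rmorphN /= (CrealP dn_real) addrA addrK lerBrDr gerDl.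
rewrite pmulr_lle0 ?invr_gt0// => d0.
have : `|d| ^+ 2 == 0 by rewrite eq_le d0 exprn_ge0.
by rewrite expf_eq0 /= normr_eq0 => /eqP.
Qed.

Lemma orth_closure (B : set H) x :
  (forall b, B b -> dot H x b = 0) -> forall a, closure B a -> dot H x a = 0.
Proof.
move=> xB a Ba; apply/orth_normP => t; apply/ler_addgt0Pr => e e0.
have d0 : 0 < e / (`|t| + 1) by rewrite divr_gt0// ltr_wpDl.
have [b [Bb]] := Ba _ (nbhsx_ballx a _ d0).
rewrite -ball_normE /ball_ /= => /ltW ab.
have /orth_normP/(_ t) := xB b Bb; move/le_trans; apply.
have -> : x + t *: b = (x + t *: a) - t *: (a - b).
  by rewrite scalerBr opprB addrACA subrr addr0.
apply: le_trans (ler_normB _ _) _; rewrite lerD2l normrZ.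
apply: le_trans (ler_wpM2l (normr_ge0 t) ab) _.
rewrite mulrCA ler_piMr ?(ltW e0)// ler_pdivrMr ?ltr_wpDl// mul1r lerDl.
exact: ler01.
Qed.

(** [p f] minimizes the distance to [g] along each line of direction [q f]. *)
Lemma opa_orth f g n p q : is_opa g f n p -> (size q <= n.+1)%N ->
  dot H (g - pmul p f) (pmul q f) = 0.
Proof.
move=> [sp p_min] sq; apply/orth_normP => t.
have /p_min : (size (p - t *: q)%R <= n.+1)%N.
  rewrite (leq_trans (size_polyD _ _))// geq_max sp size_polyN.
  exact: leq_trans (size_scale_leq _ _) sq.
have -> : g - pmul p f + t *: pmul q f = g - pmul (p - t *: q) f.
  by rewrite pmulB pmulZ opprB addrAC addrA.
by rewrite [X in _ -> X <= _]distrC [X in _ -> _ <= X]distrC.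
Qed.

Lemma opa_unique f g n p q : f != 0 -> is_opa g f n p -> (size q <= n.+1)%N ->
  (forall r : {poly R[i]}, (size r <= n.+1)%N ->
    dot H (g - pmul q f) (pmul r f) = 0) ->
  p = q.
Proof.
move=> f0 p_opa sq q_orth; apply: (pmul_inj f0); apply/eqP.
have spq : (size (p - q)%R <= n.+1)%N.
  by rewrite (leq_trans (size_polyD _ _))// geq_max p_opa.1 size_polyN.
rewrite -subr_eq0 -(dnorm_eq0 (dot H)) -pmulB {1}pmulB.
have -> : pmul p f - pmul q f = (g - pmul q f) - (g - pmul p f).
  by rewrite opprB [RHS]addrC addrA subrK.
by rewrite dotBl q_orth// (opa_orth p_opa)// subrr.
Qed.

Lemma orth_pmul x h : (forall k, dot H x (pmul 'X^k h) = 0) ->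
  forall q, dot H x (pmul q h) = 0.
Proof.
move=> xh q; rewrite /pmul; elim/big_ind: _ => [|y z xy xz|k _].
- exact: linear0r.
- by rewrite linearDr /= xy xz addr0.
- by rewrite dotZr iter_fshiftE xh mulr0.
Qed.

Lemma dot_khat0 h : dot H (khat0 H) h = (ev h 0 / `|repker H 0|)^*%R.
Proof.
rewrite /khat0 dotZl dotC -repkerP ?disk0// rmorphM /= fmorphV  /= conj_norm.
exact: mulrC.
Qed.

Lemma dot_khat0_shift k h : dot H (khat0 H) (pmul 'X^(k.+1) h) = 0.
Proof.
by rewrite dot_khat0 ev_pmul ?disk0// hornerXn expr0n /= !mul0r conjC0.
Qed.

Lemma orth_proj_cyclicP f p :
  is_orth_proj (cyclic_subspace f) (khat0 H) (pmul p f) <->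
  forall q, dot H (khat0 H - pmul p f) (pmul q f) = 0.
Proof.
split=> [[_ orth] q|orth].
  by apply: orth; apply: subset_closure; exists q.
split; first by apply: subset_closure; exists p.
by apply: orth_closure => _ [q _ <-].
Qed.

End Orthogonality.

(** * Optimal polynomial approximants to the normalized kernel at 0 *)

Section OptimalApproximants.
Variables (R : realType) (H : disk_rkhs R) (f : H) (p : nat -> {poly R[i]}).
Hypothesis f0 : ev f 0 != 0.
Hypothesis p_opa : forall n, is_opa (khat0 H) f n (p n).
Implicit Types (M n : nat) (q : {poly R[i]}).

Let f_neq0 : f != 0.
Proof. by apply: contraNneq f0 => ->; rewrite ev0// disk0. Qed.

Let k0_gt0 : 0 < `|repker H 0|.
Proof.
rewrite normr_gt0; apply: contraNneq f0 => k0.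
by rewrite repkerP ?disk0// k0 linear0r.
Qed.

Lemma stable_orthP M :
  (forall n, (M <= n)%N -> p n = p M) <->
  forall q, dot H (khat0 H - pmul (p M) f) (pmul q f) = 0.
Proof.
split=> [stab q|orth n Mn].
  rewrite -(stab (maxn M (size q)) (leq_maxl _ _)).
  by apply: (opa_orth (p_opa _)); rewrite leqW// leq_maxr.
apply: (opa_unique f_neq0 (p_opa n)) => [|q _]; last exact: orth.
exact: leq_trans (p_opa M).1 _.
Qed.

(** The hypothesis enters through T_(m+1) - T_m being a multiple a z^(m+1) of a
monomial; the induction shows that a = 0. *)
Lemma taylor_stable M (phi : R[i] -> R[i]) :
  (forall n, (M <= n)%N -> p n = taylor_poly n phi) ->
  forall n, (M <= n)%N -> p n = p M.
Proof.
move=> pT n Mn; rewrite -(subnKC Mn); elim: (n - M)%N => [|k IH].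
  by rewrite addn0.
rewrite addnS -IH; set m := (M + k)%N.
have Mm : (M <= m)%N by rewrite leq_addr.
pose a := (p m.+1)`_m.+1.
have pS : p m.+1 = p m + a *: 'X^(m.+1).
  rewrite /a !pT// ?leqW//; apply/polyP => j.
  rewrite !(coefD, coefZ, coefXn, coef_poly) ltnSn !ltnS.
  rewrite [(j <= m.+1)%N]leq_eqVlt ltnS.
  case: eqVneq => [->|_] /=; first by rewrite ltnn mulr1 add0r.
  by rewrite mulr0 addr0.
pose h := pmul 'X^(m.+1) f.
have orthm : dot H (khat0 H - pmul (p m.+1) f) h = 0.
  by apply: (opa_orth (p_opa _)); rewrite size_polyXn.
(* Both approximants have errors orthogonal to p_m f, hence so is their
   difference a h. *)
have orthd : dot H (a *: h) (pmul (p m) f) = 0.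
  have -> : a *: h = (khat0 H - pmul (p m) f) - (khat0 H - pmul (p m.+1) f).
    by rewrite pS pmulD pmulZ opprB [RHS]addrC addrA subrK addrC addKr.
  rewrite dotBl (opa_orth (p_opa m)) ?(p_opa m).1//.
  by rewrite (opa_orth (p_opa m.+1)) ?subrr// leqW// (p_opa m).1.
rewrite pS; have [->|a0] := eqVneq a 0; first by rewrite scale0r addr0.
have hm : dot H (pmul (p m) f) h = 0.
  move/eqP: orthd; rewrite dotZl mulf_eq0 (negbTE a0) => /eqP orthd.
  by rewrite dotC orthd conjC0.
(* As h vanishes at 0, the kernel is orthogonal to h too, and orthm reads
   a |h|^2 = 0. *)
move: orthm; rewrite dotBl dot_khat0_shift sub0r pS pmulD pmulZ.
rewrite linearDl /= hm add0r dotZl => /eqP.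
rewrite oppr_eq0 mulf_eq0 (negbTE a0) dnorm_eq0 => /eqP/pmul_eq0.
rewrite -size_poly_eq0 size_polyXn => /(_ isT) fz.
by move: f_neq0; rewrite fz eqxx.
Qed.

Lemma stable_taylor M : (forall n, (M <= n)%N -> p n = p M) ->
  forall n, (M <= n)%N -> p n = taylor_poly n (horner (p M)).
Proof.
move=> stab n Mn; rewrite taylor_horner ?stab//.
exact: leq_trans (p_opa M).1 _.
Qed.

Let c M := sqrtC (ev (pmul (p M) f) 0 / `|repker H 0|).

(** Zero is never optimal, since f(0) != 0 says that the kernel is not
orthogonal to f. *)
Lemma opa_neq0 M : p M != 0.
Proof.
apply: contraNneq f0 => pM0.
have := opa_orth (q := 1) (p_opa M); rewrite size_poly1 => /(_ isT).
rewrite pM0 pmul0 subr0 pmul1 dot_khat0 => /eqP.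
by rewrite conjC_eq0 mulf_eq0 invr_eq0 (gt_eqF k0_gt0) orbF.
Qed.

(** By orthogonality |g|^2 = <k, g>, where g = p_M f and k is the normalized
kernel; so the constant [c M] of the factorization is |g|. *)
Lemma opa_sqr_norm M :
  `|pmul (p M) f| ^+ 2 = ev (pmul (p M) f) 0 / `|repker H 0|.
Proof.
set g := pmul (p M) f.
have /eqP : dot H (khat0 H - g) g = 0 by exact: opa_orth (p_opa M) (p_opa M).1.
rewrite dotBl subr_eq0 dot_khat0 -norm_dot => /eqP g0.
by apply: (can_inj conjCK); rewrite g0 rmorphXn /= conj_norm.
Qed.

(** The inner function is p_M f divided by its norm. *)
Lemma orth_inner M :
  (forall q, dot H (khat0 H - pmul (p M) f) (pmul q f) = 0) ->
  exists u : H, [/\ is_inner u, p M != 0 &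
    forall z, `|z| < 1 -> (p M).[z] != 0 -> ev f z = c M * ev u z / (p M).[z]].
Proof.
move=> orth; set g := pmul (p M) f in orth *.
have g0 : g != 0.
  by apply: contraNneq f_neq0 => /pmul_eq0 ->//; apply: opa_neq0.
have cE : c M = `|g| by rewrite /c -opa_sqr_norm sqrCK.
have ng0 : `|g| != 0 by rewrite normr_eq0.
exists (`|g|^-1 *: g); split; first last.
- move=> z z1 pz0; rewrite cE evZ// mulrA divff// mul1r /g ev_pmul//.
  by rewrite mulrAC divff// mul1r.
- exact: opa_neq0.
move=> k; rewrite iter_fshiftE pmulZr dotZl dotZr fmorphV /= conj_norm.
case: k => [|k]; first by rewrite pmul1 -norm_dot expr2 mulKf// mulVf.
have /eqP := orth ('X^(k.+1) * p M).
rewrite -pmul_comp dotBl dot_khat0_shift sub0r oppr_eq0 => /eqP ->.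
by rewrite !mulr0.
Qed.

(** Optimality makes the error orthogonal to p_M f, and the inner factor makes
p_M f orthogonal to its proper shifts. *)
Lemma inner_orth M (u : H) (b : R[i]) : is_inner u -> p M != 0 ->
  (forall z, `|z| < 1 -> (p M).[z] != 0 -> ev f z = b * ev u z / (p M).[z]) ->
  forall q, dot H (khat0 H - pmul (p M) f) (pmul q f) = 0.
Proof.
move=> u_inner pM0 fE.
(* The factorization is given off the zeros of p_M; multiplying once more by p_M
   makes it hold on the whole disk. *)
have gu : pmul (p M) f = b *: u.
  apply/eqP; rewrite -subr_eq0; apply/eqP; apply: (pmul_eq0 _ pM0).
  apply: ev_inj => z z1; rewrite ev_pmul// evB// evZ// ev_pmul// ev0//.
  have [->|pz0] := eqVneq (p M).[z] 0; first by rewrite mul0r.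
  by rewrite fE// [_.[z] * (_ / _)]mulrC divfK// subrr mulr0.
have orth_g q : dot H (khat0 H - pmul (p M) f) (pmul q (pmul (p M) f)) = 0.
  apply: orth_pmul => -[|k].
    by rewrite pmul1; exact: opa_orth (p_opa M) (p_opa M).1.
  rewrite dotBl dot_khat0_shift gu pmulZr dotZl dotZr -iter_fshiftE u_inner.
  by rewrite !mulr0 subr0.
move=> q; rewrite (divp_eq q (p M)) pmulD linearDr /= -pmul_comp orth_g add0r.
apply: (opa_orth (p_opa M)); apply: leq_trans (p_opa M).1.
by rewrite ltnW// ltn_modp.
Qed.

End OptimalApproximants.

(** * Least elements *)

Lemma ex_least (P : nat -> Prop) : (exists M, P M) -> exists M, least P M.
Proof.
move=> [n Pn]; have exP : exists m, `[< P m >] by exists n; apply/asboolP.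
case: (find_ex_minn exP) => M /asboolP PM Mmin.
by exists M; split=> // m Pm; apply: Mmin; apply/asboolP.
Qed.

Lemma eq_least (P Q : nat -> Prop) M :
  (forall m, P m <-> Q m) -> least P M -> least Q M.
Proof. by move=> PQ [/PQ QM Pmin]; split=> // m /PQ; exact: Pmin. Qed.

Lemma least_least (P : nat -> Prop) M : least (least P) M <-> least P M.
Proof.
split=> [[]//|PM]; split=> // m Pm.
exact: PM.2 _ Pm.1.
Qed.

Theorem theorem3p8 (R : realType) (H : disk_rkhs R) (f : H)
    (p : nat -> {poly R[i]})
    (f0 : ev f 0 != 0)
    (p_opa : forall n, is_opa (khat0 H) f n (p n)) :
  let S1 M := exists (phi : R[i] -> R[i]) (a : nat -> R[i]),
    has_power_series phi a /\
    forall n, (M <= n)%N -> p n = taylor_poly n phi in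
  let S2 M := stabilizes_at p M in
  let S3 M :=
    is_orth_proj (cyclic_subspace f) (khat0 H) (pmul (p M) f) in
  (* ‖p_M f‖² = (p_M f)(0) / ‖k_0‖ when p_M f is the projection, hence the
     factor 1 / ‖k_0‖, which is 1 when k_0 is normalized. *)
  let S4 M :=
    let c := sqrtC (ev (pmul (p M) f) 0 / `|repker H 0|) in
    exists u : H,
      [/\ is_inner u, p M != 0 &
        forall z : R[i], `|z| < 1 -> (p M).[z] != 0 ->
          ev f z = c * ev u z / (p M).[z]] in
  [<-> exists M, S1 M; exists M, S2 M; exists M, S3 M; exists M, S4 M] /\
  (forall M, [<-> least S1 M; least S2 M; least S3 M; least S4 M]).
Proof.
move=> S1 S2 S3 S4.
pose stable M := forall n, (M <= n)%N -> p n = p M.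
have S1P M : S1 M <-> stable M.
  split=> [[phi [a [_ pT]]]|stab]; first exact: taylor_stable f0 p_opa _ _ pT.
  exists (horner (p M)), (fun k => (p M)`_k).
  by split; [exact: has_power_series_horner | exact: stable_taylor p_opa _ stab].
have S3P M : S3 M <-> stable M.
  apply: iff_trans (orth_proj_cyclicP _ _) (iff_sym _).
  exact: stable_orthP f0 p_opa _.
have S4P M : S4 M <-> stable M.
  split=> [[u [u_inner pM0 fE]]|/(stable_orthP f0 p_opa)].
    apply/(stable_orthP f0 p_opa).
    exact: inner_orth p_opa _ _ _ u_inner pM0 fE.
  exact: orth_inner f0 p_opa _.
split=> [|M].
  tfae=> -[M].
  - by move=> /S1P stabM; apply: ex_least; exists M.
  - by move=> [/S3P S3M _]; exists M.
  - by move=> /S3P/S4P S4M; exists M.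
  - by move=> /S4P/S1P S1M; exists M.
tfae.
- by move=> /(eq_least S1P) LM; apply/least_least.
- by move=> /least_least; apply: eq_least => m; apply: iff_sym.
- by apply: eq_least => m; apply: iff_trans (S3P m) (iff_sym (S4P m)).
- by apply: eq_least => m; apply: iff_trans (S4P m) (iff_sym (S1P m)).
Qed.
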